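(* Let $G$ be a compact second countable topological group with Haar measure $\lambda$, acting measurably on a measurable space $(E,\mathcal{E})$. Let $\xi$ be a nontrivial random measure on $G$ and let $X$ be a random element in $(E,\mathcal{E})$. Then the origin is a typical location for $X$ in the mass of $\xi$ if and only if for all Borel sets $C\subseteq G$ with $\lambda(C)>0$, $$\bigl(V_C^{-1}(X,\xi),\,U_CV_C\bigr)\overset{D}{=}\bigl((X,\xi),\,U_C\bigr),$$ where (i) $U_C$ is uniformly distributed on $C$ and independent of $(X,\xi)$, and (ii) $V_C$ has the conditional distribution $\xi(\,\cdot\mid U_C^{-1}C)$ given $(X,\xi,U_C)$.
   Context: $G$ is equipped with its Borel $\sigma$-algebra $\mathcal{G}$; its neutral element $e$ is called the origin. $\lambda\neq0$ is a left-invariant Haar measure on $G$ (finite and also right-invariant since $G$ is compact). ''$G$ acts measurably on $(E,\mathcal{E})$'' means that there is a group action $(t,x)\mapsto tx$ which is measurable from $G\times E$ to $E$. For a measure $\mu$ on $G$ and $t\in G$, $t\mu$ is the measure $t\mu(A)=\mu(t^{-1}A)$, $A\in\mathcal{G}$; and $t(X,\xi):=(tX,t\xi)$. $\overset{D}{=}$ denotes identity in distribution. For random elements $S$ of $G$, $S^{-1}$ denotes the group inverse. Random measures on $G$ are locally finite (hence finite here), and nontrivial means $\xi(G)>0$ almost surely. All random elements are defined on a probability space $(\Omega,\mathcal{F},\mathbb{P})$, extended if necessary to carry the auxiliary random elements $S$, $U_C$, $V_C$. For a measure $\mu$ on $G$ and $C\in\mathcal{G}$ with $0<\mu(C)<\infty$,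 $\mu(A\mid C):=\mu(A\cap C)/\mu(C)$ for $A\in\mathcal{G}$; if $\mu(C)=0$, $\mu(\cdot\mid C)$ is set equal to some fixed probability measure on $G$. ''Uniformly distributed on $C$'' means having distribution $\lambda(\cdot\mid C)$. For $u\in G$, $u^{-1}C=\{u^{-1}c:c\in C\}$. Typical locations in the mass of $\xi$: a random element $S$ in $G$ is a typical location in the mass of $\xi$ if the conditional distribution of $S$ given $\xi$ is $\xi(\cdot\mid G)$. If moreover $S$ is conditionally independent of $X$ given $\xi$, then $S$ is a typical location for $X$ in the mass of $\xi$. The origin is a typical location for $X$ in the mass of $\xi$ if $S^{-1}(X,\xi)\overset{D}{=}(X,\xi)$ where $S$ is a typical location for $X$ in the mass of $\xi$ (this property depends only on the distribution of $(X,\xi)$). *)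

(* Defs.v *)
From HB Require Import structures.
From mathcomp Require Import all_boot all_order all_algebra.
From mathcomp Require Import all_classical all_reals all_analysis.
From mathcomp Require Import measurable_realfun.

Set Implicit Arguments.
Unset Strict Implicit.
Unset Printing Implicit Defensive.

Import Order.TTheory GRing.Theory Num.Theory.

Local Open Scope classical_set_scope.
Local Open Scope ring_scope.
Local Open Scope ereal_scope.

HB.mixin Record isTopologicalGroup G & Topological G & Group G := {
  mulg_continuous : continuous (fun p : G * G => (p.1 * p.2)%g) ;
  invg_continuous : continuous (fun x : G => (x^-1)%g)
}.

#[short(type="topologicalGroupType")]
HB.structure Definition TopologicalGroup :=
  {G of Topological G & Group G & isTopologicalGroup G}.

HB.mixin Record hasBorelMeasurable (d : measure_display) G
    & TopologicalGroup G & Measurable d G := {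
  measurable_borelE : @measurable d G = <<s @open G >>
}.

#[short(type="borelGroupType")]
HB.structure Definition BorelGroup (d : measure_display) :=
  {G of TopologicalGroup G & Measurable d G & hasBorelMeasurable d G}.

Section left_translation.
Context d (G : borelGroupType d).

Definition ltrans (t : G) : G -> G := fun x => (t * x)%g.

Lemma continuous_ltrans (t : G) : continuous (ltrans t).
Proof.
move=> x.
have := @cvg_comp _ _ _ (fun y : G => (t, y)) (fun p : G * G => (p.1 * p.2)%g)
  (nbhs x) (nbhs (t, x)) (nbhs (t * x)%g).
apply; last exact: (@mulg_continuous G (t, x)).
by apply: cvg_pair; [exact: cvg_cst|exact: cvg_id].
Qed.

Lemma measurable_ltrans (t : G) : measurable_fun [set: G] (ltrans t).
Proof.
apply: (measurability (@open G)); first by rewrite measurable_borelE.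
move=> _ [U oU <-]; rewrite setTI measurable_borelE.
apply: sub_sigma_algebra; move/continuousP: (@continuous_ltrans t); exact.
Qed.

HB.instance Definition _ (t : G) :=
  isMeasurableFun.Build d d G G (ltrans t) (measurable_ltrans t).

End left_translation.

(* The space of finite measures on T, with the sigma-algebra generated by the
   evaluations mu |-> mu A, A measurable. Two elements that agree on the
   measurable sets need not be Leibniz-equal, but no measurable set separates
   them. *)
Section finite_measures.
Context d (T : measurableType d) (R : realType).

Definition finite_measures : Type := {finite_measure set T -> \bar R}.

HB.instance Definition _ :=
  @Measure_isFinite.Build d T R (@mzero d T R) (fun _ _ => isT).

HB.instance Definition _ := gen_eqMixin finite_measures.
HB.instance Definition _ := gen_choiceMixin finite_measures.
HB.instance Definition _ := isPointed.Build finite_measures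
  (@mzero d T R : {finite_measure set T -> \bar R}).

Definition finite_measures_ev (mu : finite_measures) (A : set T) : \bar R :=
  (mu : {finite_measure set T -> \bar R}) A.

Definition preimg_finite_measures_ev (A : set T) : set_system finite_measures :=
  preimage_set_system [set: finite_measures] (finite_measures_ev ^~ A)
    measurable.

Definition finite_measures_measurable :=
  <<s \bigcup_(A in measurable) preimg_finite_measures_ev A >>.

Let finite_measures_measurable0 : finite_measures_measurable set0.
Proof. exact: sigma_algebra0. Qed.

Let finite_measures_measurableC (U : set finite_measures) :
  finite_measures_measurable U -> finite_measures_measurable (~` U).
Proof. exact: sigma_algebraC. Qed.

Let finite_measures_measurableU (F : (set finite_measures)^nat) :
  (forall i, finite_measures_measurable (F i)) ->
  finite_measures_measurable (\bigcup_i F i).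
Proof. exact: sigma_algebra_bigcup. Qed.

Definition finite_measures_display : measure_display.
Proof. by constructor. Qed.

HB.instance Definition _ :=
  @isMeasurable.Build finite_measures_display finite_measures
    finite_measures_measurable finite_measures_measurable0
    finite_measures_measurableC finite_measures_measurableU.

End finite_measures.

Section translation_measure.
Context d (G : borelGroupType d) (R : realType).
Variables (t : G) (mu : finite_measures G R).

Definition translate_setfun : set G -> \bar R :=
  pushforward (mu : {finite_measure set G -> \bar R}) (ltrans t).

Let translate0 : translate_setfun set0 = 0.
Proof. exact: measure0. Qed.

Let translate_ge0 A : 0 <= translate_setfun A.
Proof. exact: measure_ge0. Qed.

Let translate_sigma_additive : semi_sigma_additive translate_setfun.
Proof. exact: measure_semi_sigma_additive. Qed.

HB.instance Definition _ := isMeasure.Build _ _ _ translate_setfun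
  translate0 translate_ge0 translate_sigma_additive.

Let translate_finite : fin_num_fun translate_setfun.
Proof.
move=> A mA; apply: fin_num_measure.
by rewrite -[X in measurable X]setTI; exact: measurable_funPT.
Qed.

HB.instance Definition _ :=
  Measure_isFinite.Build _ _ _ translate_setfun translate_finite.

(* (t mu)(A) = mu (t^-1 A): the preimage of A under left translation by t is
   t^-1 A. *)
Definition translate_measure : finite_measures G R :=
  (translate_setfun : {finite_measure set G -> \bar R}).

End translation_measure.

Definition haar_measure d (G : borelGroupType d) (R : realType)
    (lambda : {measure set G -> \bar R}) : Prop :=
  [/\ lambda [set: G] != 0,
      forall K : set G, measurable K -> compact K -> lambda K < +oo &
      forall (t : G) (A : set G), measurable A ->
        lambda (ltrans t @` A) = lambda A].

Definition measurable_action d (G : borelGroupType d) dE (E : measurableType dE)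
    (act : G -> E -> E) : Prop :=
  [/\ forall x, act 1%g x = x,
      forall s t x, act (s * t)%g x = act s (act t x) &
      measurable_fun [set: G * E] (fun p : G * E => act p.1 p.2)].

Definition pair_action d (G : borelGroupType d) dE (E : measurableType dE)
    (R : realType) (act : G -> E -> E) (t : G) (z : E * finite_measures G R) :
    E * finite_measures G R :=
  (act t z.1, translate_measure t z.2).

(* mu( . | C), set to nu when mu C = 0 *)
Definition cond_measure d (T : measurableType d) (R : realType)
    (nu : probability T R) (mu : set T -> \bar R) (C : set T) : set T -> \bar R :=
  fun A => if mu C == 0 then nu A else mu (A `&` C) * (fine (mu C))^-1%:E.

Section probabilistic_notions.
Context d (Omega : measurableType d) (R : realType) (P : probability Omega R).

Definition eq_in_distribution d' (T : measurableType d') (Y Z : Omega -> T) :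
    Prop :=
  forall A, measurable A -> pushforward P Y A = pushforward P Z A.

Definition independent d1 (T1 : measurableType d1) d2 (T2 : measurableType d2)
    (Y : Omega -> T1) (Z : Omega -> T2) : Prop :=
  forall A B, measurable A -> measurable B ->
    P (Y @^-1` A `&` Z @^-1` B) = P (Y @^-1` A) * P (Z @^-1` B).

(* f(Y) is a version of P(F | Y) *)
Definition cond_probability dY (TY : measurableType dY) (Y : Omega -> TY)
    (F : set Omega) (f : TY -> \bar R) : Prop :=
  measurable_fun [set: TY] f /\
  forall B, measurable B ->
    \int[P]_(w in Y @^-1` B) f (Y w) = P (F `&` Y @^-1` B).

Definition cond_distribution dY (TY : measurableType dY) (Y : Omega -> TY)
    dS (TS : measurableType dS) (S : Omega -> TS)
    (kappa : TY -> set TS -> \bar R) : Prop :=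
  forall A, measurable A -> cond_probability Y (S @^-1` A) (kappa ^~ A).

Definition cond_independent d1 (T1 : measurableType d1)
    d2 (T2 : measurableType d2) dY (TY : measurableType dY)
    (S : Omega -> T1) (X : Omega -> T2) (Y : Omega -> TY) : Prop :=
  forall A B, measurable A -> measurable B ->
    exists f g : TY -> \bar R,
      [/\ cond_probability Y (S @^-1` A) f,
          cond_probability Y (X @^-1` B) g &
          cond_probability Y (S @^-1` A `&` X @^-1` B) (fun y => f y * g y)].

Definition typical_location_for dG (G : borelGroupType dG)
    dE (E : measurableType dE) (nu : probability G R)
    (X : Omega -> E) (xi : Omega -> finite_measures G R) (S : Omega -> G) :
    Prop :=
  cond_distribution xi S (fun mu => cond_measure nu mu [set: G]) /\
  cond_independent S X xi.

(* An extended probability space; a random element Y of Omega becomes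
   Y \o ext_proj on it. *)
Record extension := Extension {
  ext_disp : measure_display ;
  ext_space : measurableType ext_disp ;
  ext_prob : probability ext_space R ;
  ext_proj : {mfun ext_space >-> Omega} ;
  ext_law : forall A, measurable A -> pushforward ext_prob ext_proj A = P A
}.

End probabilistic_notions.

Arguments ext_space {d Omega R P} e.
Arguments ext_prob {d Omega R P} e.
Arguments ext_proj {d Omega R P} e.

(* The law of (S, X, xi) depends neither on the extension nor on the choice of
   S. The first clause, that some extension carries a typical location, is
   there so that the second cannot hold vacuously. *)
Definition origin_typical d (Omega : measurableType d) (R : realType)
    (P : probability Omega R) dG (G : borelGroupType dG)
    dE (E : measurableType dE) (act : G -> E -> E) (nu : probability G R)
    (X : Omega -> E) (xi : Omega -> finite_measures G R) : Prop :=
  (exists (Q : extension P) (S : {mfun ext_space Q >-> G}),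
    typical_location_for (ext_prob Q) nu (X \o ext_proj Q) (xi \o ext_proj Q) S)
  /\
  (forall (Q : extension P) (S : {mfun ext_space Q >-> G}),
    typical_location_for (ext_prob Q) nu
      (X \o ext_proj Q) (xi \o ext_proj Q) S ->
    eq_in_distribution (ext_prob Q)
      (fun w => pair_action act (S w)^-1%g
                  (X (ext_proj Q w), xi (ext_proj Q w)))
      (fun w => (X (ext_proj Q w), xi (ext_proj Q w)))).

(* In the third clause y = ((x, mu), u) is a value of (X, xi, U), and the
   conditional distribution of V is mu( . | u^-1 C). *)
Definition uniform_typical_pair d (Omega : measurableType d) (R : realType)
    (P : probability Omega R) dG (G : borelGroupType dG)
    dE (E : measurableType dE) (nu : probability G R)
    (lambda : {measure set G -> \bar R}) (C : set G)
    (X : Omega -> E) (xi : Omega -> finite_measures G R) (U V : Omega -> G) :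
    Prop :=
  [/\ forall A, measurable A -> pushforward P U A = cond_measure nu lambda C A,
      independent P U (fun w => (X w, xi w)) &
      cond_distribution P (fun w => ((X w, xi w), U w)) V
        (fun y => cond_measure nu y.1.2 (ltrans y.2^-1%g @` C))].

Definition uniform_shift_identity d (Omega : measurableType d) (R : realType)
    (P : probability Omega R) dG (G : borelGroupType dG)
    dE (E : measurableType dE) (act : G -> E -> E)
    (X : Omega -> E) (xi : Omega -> finite_measures G R) (U V : Omega -> G) :
    Prop :=
  eq_in_distribution P
    (fun w => (pair_action act (V w)^-1%g (X w, xi w), (U w * V w)%g))
    (fun w => ((X w, xi w), U w)).

(* Main.v *)
Require Import Defs.
From HB Require Import structures.
From mathcomp Require Import all_boot all_order all_algebra.
From mathcomp Require Import all_classical all_reals all_analysis.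
From mathcomp Require Import measurable_realfun.

Set Implicit Arguments.
Unset Strict Implicit.
Unset Printing Implicit Defensive.

Import Order.TTheory GRing.Theory Num.Theory.

Local Open Scope classical_set_scope.
Local Open Scope ring_scope.
Local Open Scope ereal_scope.

(** Write z = (x, mu) for a value of (X, xi), p for the law of (X, xi), k_z for
    the normalized measure mu / mu(G), and lambda for the Haar measure.

    Typicality of the origin is a property of p alone. A typical location S for
    X has conditional law k_z given (X, xi) = z, because conditional
    independence of S and X given xi allows X to be added to the condition
    ([cond_distribution_pair]). So the origin is typical if and only if p is
    invariant under a backward shift by a point drawn from k_z:

      (1)  int p(dz) g(z) = int p(dz) int k_z(ds) g(s^-1 z)   for all g >= 0

    ([origin_typicalP], [mass_invariant_integral]). If C is the whole group,
    V_C is a typical location, and the shift identity for C, with U_C V_C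
    forgotten, is (1). This gives one implication.

    For the other one, assume (1) and fix C and a measurable set A of pairs
    (z, u). Let J(z, u) be the probability that a point v with law k_z( . |
    u^-1 C) satisfies (v^-1 z, u v) in A, and let J(z, u) = 0 if u^-1 C has no
    mass. As k_(s^-1 z) is the image of k_z under s^-1, J is equivariant:
    J(s^-1 z, w s) = J(z, w). Substitute u = w s in the Haar integral, which is
    also right invariant, exchange integrals, use
    J(z, w) k_z(w^-1 C) = k_z {v : w v in C, (v^-1 z, w v) in A}, and substitute
    u = w v:

      int k_z(ds) int_C lambda(du) J(s^-1 z, u)
        = int lambda(dw) J(z, w) k_z(w^-1 C)
        = int k_z(dv) int_C lambda(du) 1_A(v^-1 z, u).

    Both sides have the form of the right-hand side of (1), so integration
    against p gives

      int p(dz) int_C lambda(du) J(z, u) = int p(dz) int_C lambda(du) 1_A(z, u)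

    ([mass_transport]). After division by lambda(C) the right-hand side is the
    probability that ((X, xi), U_C) is in A, and the left-hand side is at most
    the probability that (V_C^-1 (X, xi), U_C V_C) is in A, since J drops the
    case in which xi does not charge U_C^-1 C. Two probability measures that
    are ordered on every measurable set are equal ([probability_le_eq]), and
    this also shows that the dropped case has probability zero.

    The random elements S, U_C and V_C are realized on semidirect products of
    the given space with a probability kernel, and Radon-Nikodym densities
    provide the conditional probabilities of X given xi. *)

(** * Measures on products and probability kernels *)

Lemma measurable_preimageT d1 d2 (T1 : measurableType d1)
    (T2 : measurableType d2) (f : T1 -> T2) (A : set T2) :
  measurable_fun [set: T1] f -> measurable A -> measurable (f @^-1` A).
Proof. by move=> mf mA; rewrite -[X in measurable X]setTI; exact: mf. Qed.

Lemma finite_measure_eq_rectangles d1 d2 (T1 : measurableType d1)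
    (T2 : measurableType d2) (R : realType)
    (m1 m2 : {measure set (T1 * T2) -> \bar R}) :
  m1 [set: T1 * T2] < +oo ->
  (forall A B, measurable A -> measurable B -> m1 (A `*` B) = m2 (A `*` B)) ->
  forall D, measurable D -> m1 D = m2 D.
Proof.
move=> m1oo m12 D mD.
pose G := [set A `*` B | A in @measurable d1 T1 & B in @measurable d2 T2].
apply: (measure_unique G (fun=> setT)) => //.
- by rewrite measurable_prod_measurableType.
- move=> _ _ [A1 mA1 [B1 mB1 <-]] [A2 mA2 [B2 mB2 <-]].
  rewrite -setXI; exists (A1 `&` A2); first exact: measurableI.
  by exists (B1 `&` B2) => //; exact: measurableI.
- by move=> _; exists setT => //; exists setT => //; rewrite setXTT.
- by rewrite bigcup_const.
- by move=> _ [A mA [B mB <-]]; exact: m12.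
Qed.

Section pullback_kernel.
Context d1 d2 d3 (T1 : measurableType d1) (T2 : measurableType d2)
  (S : measurableType d3) (R : realType).
Variables (K : R.-pker T2 ~> S) (f : {mfun T1 >-> T2}).

Definition kpullback : T1 -> {measure set S -> \bar R} := fun x => K (f x).

Let measurable_kpullback U : measurable U ->
  measurable_fun [set: T1] (kpullback ^~ U).
Proof.
move=> mU; apply: (measurableT_comp (measurable_kernel K U mU)).
exact: measurable_funPT.
Qed.

HB.instance Definition _ := isKernel.Build _ _ _ _ _ kpullback
  measurable_kpullback.

Let kpullback_prob x : kpullback x [set: S] = 1.
Proof. exact: prob_kernel. Qed.

HB.instance Definition _ := Kernel_isProbability.Build _ _ _ _ _
  kpullback kpullback_prob.

End pullback_kernel.

Section constant_kernel.
Context d1 d2 (T : measurableType d1) (S : measurableType d2) (R : realType).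
Variable Q : probability S R.

Definition kconst : T -> {measure set S -> \bar R} := fun=> Q.

Let measurable_kconst U : measurable U ->
  measurable_fun [set: T] (kconst ^~ U).
Proof. by move=> mU; exact: measurable_cst. Qed.

HB.instance Definition _ := isKernel.Build _ _ _ _ _ kconst measurable_kconst.

Let kconst_prob x : kconst x [set: S] = 1.
Proof. exact: probability_setT. Qed.

HB.instance Definition _ := Kernel_isProbability.Build _ _ _ _ _
  kconst kconst_prob.

End constant_kernel.

(** The parameter of type unit in [kgraph] makes the integral of [graph_law]
    over a probability measure on Y an instance of the composition of kernels,
    which comes with its integration formula. *)
Section graph_kernel.
Context d1 d2 (Y : measurableType d1) (S : measurableType d2) (R : realType).
Variable K : R.-pker Y ~> S.

Definition graph_law (y : Y) : set (Y * S) -> \bar R :=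
  pushforward (K y) (pair y).

Let graph_law0 y : graph_law y set0 = 0.
Proof. by rewrite /graph_law /pushforward preimage_set0 measure0. Qed.

Let graph_law_ge0 y A : 0 <= graph_law y A.
Proof. exact: measure_ge0. Qed.

Let graph_law_sigma_additive y : semi_sigma_additive (graph_law y).
Proof. by apply: measure_semi_sigma_additive; exact: pair1_measurable. Qed.

HB.instance Definition _ y := isMeasure.Build _ _ _ (graph_law y)
  (graph_law0 y) (graph_law_ge0 y) (@graph_law_sigma_additive y).

Definition kgraph (uy : unit * Y) : {measure set (Y * S) -> \bar R} :=
  graph_law uy.2.

Let measurable_kgraph U : measurable U ->
  measurable_fun [set: unit * Y] (kgraph ^~ U).
Proof.
move=> mU; rewrite /kgraph /graph_law /pushforward /=.
have -> : (fun x : unit * Y => K x.2 (pair x.2 @^-1` U)) =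
   (fun x => K x (xsection U x)) \o snd.
  by apply/funext => -[u y] /=; rewrite xsectionE.
apply: measurableT_comp measurable_snd.
by apply: measurable_fun_xsection_finite_kernel; rewrite inE.
Qed.

HB.instance Definition _ := isKernel.Build _ _ _ _ _ kgraph measurable_kgraph.

Let kgraph_prob x : kgraph x [set: Y * S] = 1.
Proof. exact: prob_kernel. Qed.

HB.instance Definition _ := Kernel_isProbability.Build _ _ _ _ _
  kgraph kgraph_prob.

End graph_kernel.

(** The law of (y, s) when y is drawn from p and then s from [K y]. *)
Section semidirect_product.
Context d1 d2 (Y : measurableType d1) (S : measurableType d2) (R : realType).
Variables (p : probability Y R) (K : R.-pker Y ~> S).

Definition semidirect : set (Y * S) -> \bar R :=
  kcomp (@kconst _ _ unit Y R p) (kgraph K) tt.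

HB.instance Definition _ := Measure.on semidirect.

Lemma semidirectE A : semidirect A = \int[p]_y K y (pair y @^-1` A).
Proof. by []. Qed.

Let semidirectT : semidirect [set: Y * S] = 1.
Proof.
rewrite semidirectE (eq_integral (cst 1)).
  by rewrite integral_cst// mul1e; exact: probability_setT.
by move=> y _; rewrite preimage_setT prob_kernel.
Qed.

HB.instance Definition _ :=
  Measure_isProbability.Build _ _ _ semidirect semidirectT.

Lemma semidirect_rectangle A B :
  semidirect (A `*` B) = \int[p]_(y in A) K y B.
Proof.
rewrite semidirectE [RHS]integral_mkcond; apply: eq_integral => y _.
rewrite patchE; case: ifPn => yA.
  congr (K y _); apply/seteqP; split => s /=; first by case.
  by move=> Bs; split => //; exact/set_mem.
rewrite (_ : _ @^-1` _ = set0) ?measure0//.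
apply/seteqP; split => // s /= [Ay _].
by move/negP: yA; apply; rewrite inE.
Qed.

Lemma ge0_integral_semidirect (h : Y * S -> \bar R) :
  measurable_fun [set: Y * S] h -> (forall x, 0 <= h x) ->
  \int[semidirect]_x h x = \int[p]_y \int[K y]_s h (y, s).
Proof.
move=> mh h0; rewrite /semidirect integral_kcomp//.
apply: eq_integral => y _ /=; rewrite /kgraph /graph_law /=.
by rewrite ge0_integral_pushforward//; exact: pair1_measurable.
Qed.

End semidirect_product.

(** [kernel_at] is [k x] with its structure of a probability measure, which
    Tonelli's theorem requires. *)
Section kernel_tonelli.
Context d1 d2 d3 (X : measurableType d1) (Y : measurableType d2)
  (T : measurableType d3) (R : realType).
Variables (k : R.-pker X ~> Y) (x : X) (m : {finite_measure set T -> \bar R}).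

Definition kernel_at : set Y -> \bar R := k x.

HB.instance Definition _ := Measure.on kernel_at.

HB.instance Definition _ :=
  Measure_isProbability.Build _ _ _ kernel_at (prob_kernel x).

Lemma kernel_tonelli (f : Y * T -> \bar R) :
  measurable_fun [set: Y * T] f -> (forall y, 0 <= f y) ->
  \int[k x]_y \int[m]_t f (y, t) = \int[m]_t \int[k x]_y f (y, t).
Proof. by move=> mf f0; exact: (@fubini_tonelli _ _ _ _ _ kernel_at m). Qed.

End kernel_tonelli.

Lemma integrable_kernel d1 d2 (T : measurableType d1) (S : measurableType d2)
    (R : realType) (m : {finite_measure set T -> \bar R}) (K : R.-pker T ~> S)
    (A : set S) (D : set T) :
  measurable A -> measurable D -> m.-integrable D (K ^~ A).
Proof.
move=> mA mD; apply: (@le_integrable _ _ _ _ _ mD _ (cst 1)).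
- by apply: measurable_funTS; exact: measurable_kernel.
- move=> y _; rewrite gee0_abs// abse1 -(@prob_kernel _ _ _ _ _ K y).
  by apply: le_measure; rewrite ?inE.
- exact: finite_measure_integrable_cst.
Qed.

Lemma ge0_integral_mrestr d (T : measurableType d) (R : realType)
    (mu : {measure set T -> \bar R}) (B : set T) (mB : measurable B)
    (D : set T) (f : T -> \bar R) :
  measurable D -> measurable_fun D f -> (forall x, D x -> 0 <= f x) ->
  \int[mrestr mu mB]_(x in D) f x = \int[mu]_(x in D `&` B) f x.
Proof.
move=> mD mf f0; have mBC := measurableC mB.
rewrite [LHS](@ge0_negligible_integral _ _ _ _ _ (~` B))//; last first.
  by transitivity (mu (~` B `&` B)) => //; rewrite setICl measure0.
rewrite setDE setCK; apply: eq_measure_integral => A mA AB.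
transitivity (mu (A `&` B)) => //.
by rewrite setIidl//; move=> w /AB[].
Qed.

Section integral_conditioned.
Context d (T : measurableType d) (R : realType).
Variables (m : {finite_measure set T -> \bar R}) (nu : probability T R).
Variables (C : set T) (mC : measurable C).

Definition conditioned : probability T R := mnormalize (mrestr m mC) nu.

Lemma cond_measureE A : cond_measure nu m C A = conditioned A.
Proof.
rewrite /conditioned /cond_measure /= /mnormalize /= /mrestr setTI.
have /negbTE -> : m C != +oo.
  by rewrite -ltey -ge0_fin_numE// fin_num_measure.
by rewrite orbF; case: ifP.
Qed.

Lemma ge0_integral_conditioned (f : T -> \bar R) : 0 < m C ->
  measurable_fun [set: T] f -> (forall x, 0 <= f x) ->
  \int[conditioned]_x f x =
  (fine (m C))^-1%:E * \int[m]_x ((\1_C x)%:E * f x).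
Proof.
move=> mC0 mf f0.
have fC0 : (0 <= (fine (m C))^-1)%R by rewrite invr_ge0 fine_ge0.
transitivity (\int[mscale (NngNum fC0) (mrestr m mC)]_x f x).
  apply: eq_measure_integral => A mA _.
  transitivity (conditioned A) => //; rewrite -cond_measureE /cond_measure gt_eqF//.
  by rewrite muleC.
rewrite ge0_integral_mscale//= ge0_integral_mrestr// setTI; congr (_ * _).
rewrite [LHS]integral_mkcond; apply: eq_integral => x _.
by rewrite patchE indicE; case: ifP => _; rewrite ?mul1e ?mul0e.
Qed.

End integral_conditioned.

Section as_finite_measure.
Context d (T : measurableType d) (R : realType).
Variables (mu : {measure set T -> \bar R}) (mu_finite : mu [set: T] < +oo).

(** The argument carries the proof that the finite measure structure needs. *)
Definition as_finite_measure of mu [set: T] < +oo : set T -> \bar R := mu.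

HB.instance Definition _ := Measure.on (as_finite_measure mu_finite).

Let as_finite_measure_fin : fin_num_fun (as_finite_measure mu_finite).
Proof. exact: lty_fin_num_fun. Qed.

HB.instance Definition _ := Measure_isFinite.Build _ _ _
  (as_finite_measure mu_finite) as_finite_measure_fin.

End as_finite_measure.

(** The inequality for the complement of A is the converse inequality for A. *)
Lemma probability_le_eq d (T : measurableType d) (R : realType)
    (p q : probability T R) :
  (forall A, measurable A -> p A <= q A) ->
  forall A, measurable A -> p A = q A.
Proof.
move=> pq A mA; apply/le_anti/andP; split; first exact: pq.
have := pq _ (measurableC mA).
by rewrite !probability_setC// leeD2lE// leeN2.
Qed.

(** * Conditional distributions and joint laws *)

Definition mk_mfun d1 d2 (T1 : measurableType d1) (T2 : measurableType d2)
    (f : T1 -> T2) (mf : measurable_fun [set: T1] f) : {mfun T1 >-> T2} :=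
  HB.pack f (isMeasurableFun.Build _ _ _ _ f mf).

Definition mfun_pair d d1 d2 (T : measurableType d) (T1 : measurableType d1)
    (T2 : measurableType d2) (f : {mfun T >-> T1}) (g : {mfun T >-> T2}) :
    {mfun T >-> (T1 * T2)%type} :=
  mk_mfun (measurable_fun_pair (measurable_funPT f) (measurable_funPT g)).

Section conditional_distributions.
Context d (Omega : measurableType d) (R : realType) (P : probability Omega R).
Context dY (TY : measurableType dY) dS (TS : measurableType dS).
Variables (Y : {mfun Omega >-> TY}) (S : {mfun Omega >-> TS}).
Variable K : R.-pker TY ~> TS.

Lemma cond_distributionP (kappa : TY -> set TS -> \bar R) :
  (forall y A, measurable A -> kappa y A = K y A) ->
  cond_distribution P Y S kappa <->
  forall A B, measurable A -> measurable B ->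
    \int[P]_(w in Y @^-1` B) K (Y w) A = P (S @^-1` A `&` Y @^-1` B).
Proof.
move=> kE; split => [h A B mA mB|h A mA]; last split.
- have [_ <-//] := h A mA.
  by apply: eq_integral => w _; rewrite kE.
- rewrite (_ : kappa ^~ A = K ^~ A); first exact: measurable_kernel.
  by apply/funext => y; exact: kE.
- by move=> B mB; rewrite -h//; apply: eq_integral => w _; exact: kE.
Qed.

(** The two measures agree on rectangles. *)
Lemma law_of_cond_distribution (kappa : TY -> set TS -> \bar R) :
  (forall y A, measurable A -> kappa y A = K y A) ->
  cond_distribution P Y S kappa ->
  forall D, measurable D ->
    distribution P (mfun_pair Y S) D = semidirect (distribution P Y) K D.
Proof.
move=> kE /(cond_distributionP kE) h D mD.
apply: finite_measure_eq_rectangles => //.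
  by rewrite -ge0_fin_numE// fin_num_measure.
move=> A B mA mB; rewrite [RHS]semidirect_rectangle//.
rewrite ge0_integral_pushforward//; last first.
  by apply: measurable_funTS; exact: measurable_kernel.
rewrite [RHS]h// setIC.
by congr (P _); apply/seteqP; split => w [].
Qed.

End conditional_distributions.

(** The law of Y is compared with q on measurable sets only: this is how the laws
    of (X, xi) on the given space and on an extension are related. *)
Section law_from_conditionals.
Context d (Omega : measurableType d) (R : realType) (P : probability Omega R).
Context dY (TY : measurableType dY) dS (TS : measurableType dS).
Variables (Y : {mfun Omega >-> TY}) (S : {mfun Omega >-> TS}).
Variables (q : probability TY R) (K : R.-pker TY ~> TS).
Variable kappa : TY -> set TS -> \bar R.
Hypothesis Yq : forall A, measurable A -> distribution P Y A = q A.
Hypothesis kE : forall y A, measurable A -> kappa y A = K y A.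
Hypothesis YS : cond_distribution P Y S kappa.

Lemma joint_law D : measurable D ->
  P ((fun w => (Y w, S w)) @^-1` D) = semidirect q K D.
Proof.
move=> mD; transitivity (semidirect (distribution P Y) K D).
  exact: (law_of_cond_distribution kE YS mD).
by rewrite !semidirectE; apply: eq_measure_integral => A mA _; exact: Yq.
Qed.

End law_from_conditionals.

Lemma cond_distribution_comp d (Omega : measurableType d) (R : realType)
    (P : probability Omega R) d1 (T1 : measurableType d1) d2
    (T2 : measurableType d2) dS (TS : measurableType dS)
    (Y : {mfun Omega >-> T1}) (S : {mfun Omega >-> TS})
    (g : {mfun T1 >-> T2}) (K : R.-pker T2 ~> TS)
    (kappa1 : T1 -> set TS -> \bar R) (kappa2 : T2 -> set TS -> \bar R) :
  (forall y A, measurable A -> kappa1 y A = K (g y) A) ->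
  (forall y A, measurable A -> kappa2 y A = K y A) ->
  cond_distribution P Y S kappa1 -> cond_distribution P (g \o Y) S kappa2.
Proof.
move=> k1E k2E.
have k1E' y A : measurable A -> kappa1 y A = kpullback K g y A by exact: k1E.
move=> /(cond_distributionP _ _ _ k1E') h.
apply/(@cond_distributionP _ _ _ _ _ _ _ _ (g \o Y) _ _ _ k2E) => A B mA mB.
by rewrite -[RHS](h A (g @^-1` B))//; exact: measurable_preimageT.
Qed.

(** * Extensions of the probability space *)

Section semidirect_extension.
Context d (Omega : measurableType d) (R : realType) (P : probability Omega R).
Context dY (TY : measurableType dY) dS (TS : measurableType dS).
Variables (Y : {mfun Omega >-> TY}) (K : R.-pker TY ~> TS).

Let PK : probability (Omega * TS)%type R := semidirect P (kpullback K Y).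

Let marginal A : measurable A ->
  pushforward PK (mk_mfun (@measurable_fst _ _ Omega TS)) A = P A.
Proof.
move=> mA; rewrite /pushforward (_ : _ @^-1` A = A `*` setT); last first.
  by apply/seteqP; split => [[w s]|[w s] []].
rewrite [LHS]semidirect_rectangle//.
under eq_integral do rewrite prob_kernel.
by rewrite integral_cst// mul1e.
Qed.

Definition semidirect_extension : extension P := Extension marginal.

Lemma semidirect_extension_cond (kappa : TY -> set TS -> \bar R) :
  (forall y A, measurable A -> kappa y A = K y A) ->
  cond_distribution (ext_prob semidirect_extension)
    (Y \o ext_proj semidirect_extension)
    (mk_mfun (@measurable_snd _ _ Omega TS)) kappa.
Proof.
move=> kE.
apply/(@cond_distributionP _ _ _ _ _ _ _ _
  (Y \o ext_proj semidirect_extension) _ K _ kE).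
move=> A B mA mB.
rewrite (_ : _ `&` _ = (Y @^-1` B) `*` A); last first.
  by apply/seteqP; split => [[w s] []|[w s] []].
have mYB : measurable (Y @^-1` B) by apply: measurable_preimageT.
rewrite [RHS]semidirect_rectangle//.
rewrite -(@eq_measure_integral _ _ _ _ P
  (distribution PK (mk_mfun (@measurable_fst _ _ Omega TS)))); last first.
  by move=> D mD _; exact: marginal.
rewrite ge0_integral_pushforward//.
by apply: measurable_funTS; exact: measurable_kernel.
Qed.

End semidirect_extension.

Section extension_law.
Context d (Omega : measurableType d) (R : realType) (P : probability Omega R).

Lemma extension_law (Q : extension P) d' (T : measurableType d')
    (Y : {mfun Omega >-> T}) A : measurable A ->
  distribution (ext_prob Q) (Y \o ext_proj Q) A = distribution P Y A.
Proof.
by move=> mA; rewrite -[RHS](ext_law Q)//; exact: measurable_preimageT.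
Qed.

End extension_law.

Section composed_extension.
Context d (Omega : measurableType d) (R : realType) (P : probability Omega R).
Variables (Q : extension P) (Q' : extension (ext_prob Q)).

Let comp_law A : measurable A ->
  pushforward (ext_prob Q') (ext_proj Q \o ext_proj Q') A = P A.
Proof. by move=> mA; rewrite -(ext_law Q mA); exact: extension_law. Qed.

Definition comp_extension : extension P := Extension comp_law.

End composed_extension.

(** * Conditional independence *)

Section independence.
Context d (Omega : measurableType d) (R : realType) (P : probability Omega R).
Context d1 (T1 : measurableType d1) d2 (T2 : measurableType d2).
Variables (U : {mfun Omega >-> T1}) (Y : {mfun Omega >-> T2}).
Variable Q : probability T1 R.

Lemma cond_distribution_independent :
  (forall A, measurable A -> pushforward P U A = Q A) ->
  (independent P U Y <-> cond_distribution P Y U (fun=> Q)).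
Proof.
move=> UQ; have kE (y : T2) A : measurable A -> Q A = @kconst _ _ T2 _ _ Q y A by [].
have cst B A : measurable B -> measurable A ->
    \int[P]_(w in Y @^-1` B) @kconst _ _ T2 _ _ Q (Y w) A =
    P (U @^-1` A) * P (Y @^-1` B).
  move=> mB mA; have mYB : measurable (Y @^-1` B) by exact: measurable_preimageT.
  by rewrite /kconst integral_cst// -UQ.
split => [ind|/(cond_distributionP _ _ _ kE) h A B mA mB].
  by apply/(cond_distributionP _ _ _ kE) => A B mA mB; rewrite cst// ind.
by rewrite -h// cst.
Qed.

End independence.

(** Integrability is not assumed because a version of a conditional probability
    is only known to be measurable. *)
Lemma integral_law d (Omega : measurableType d) (R : realType)
    (P : probability Omega R) dY (TY : measurableType dY)
    (Y : {mfun Omega >-> TY}) (f : TY -> \bar R) B :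
  measurable_fun [set: TY] f -> measurable B ->
  \int[distribution P Y]_(y in B) f y = \int[P]_(w in Y @^-1` B) f (Y w).
Proof.
move=> mf mB; rewrite [LHS]integralE [RHS]integralE.
have -> : (fun w => f (Y w))^\+ = f^\+ \o Y by rewrite -funepos_comp.
have -> : (fun w => f (Y w))^\- = f^\- \o Y by rewrite -funeneg_comp.
rewrite !ge0_integral_pushforward//.
- by apply: measurable_funTS; exact: measurable_funeneg.
- by apply: measurable_funTS; exact: measurable_funepos.
Qed.

(** The image under Y of P restricted to the event B: a finite measure with
    density P(B | Y) with respect to the law of Y. *)
Section restricted_law.
Context d (Omega : measurableType d) (R : realType) (P : probability Omega R).
Context dY (TY : measurableType dY) (Y : {mfun Omega >-> TY}).
Variables (B : set Omega) (mB : measurable B).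

Definition restricted_law : set TY -> \bar R := pushforward (mrestr P mB) Y.

Let restricted_law0 : restricted_law set0 = 0.
Proof. exact: measure0. Qed.

Let restricted_law_ge0 A : 0 <= restricted_law A.
Proof. exact: measure_ge0. Qed.

Let restricted_law_sigma_additive : semi_sigma_additive restricted_law.
Proof. by apply: measure_semi_sigma_additive; exact: measurable_funPT. Qed.

HB.instance Definition _ := isMeasure.Build _ _ _ restricted_law
  restricted_law0 restricted_law_ge0 restricted_law_sigma_additive.

Let restricted_law_fin : fin_num_fun restricted_law.
Proof.
move=> A mA; rewrite /restricted_law /pushforward /mrestr.
by apply: fin_num_measure; apply: measurableI => //; exact: measurable_preimageT.
Qed.

HB.instance Definition _ :=
  Measure_isFinite.Build _ _ _ restricted_law restricted_law_fin.

Lemma restricted_lawE A : restricted_law A = P (Y @^-1` A `&` B).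
Proof. by []. Qed.

Lemma restricted_law_dominated : restricted_law `<< distribution P Y.
Proof.
apply/null_content_dominatesP => A mA PA0; apply/eqP.
have mYA : measurable (Y @^-1` A) by exact: measurable_preimageT.
rewrite -measure_le0 -[leRHS]PA0.
by apply: le_measure; rewrite ?inE//; exact: measurableI.
Qed.

Lemma ge0_integral_restricted_law (f : TY -> \bar R) D : measurable D ->
  measurable_fun [set: TY] f -> (forall y, 0 <= f y) ->
  \int[restricted_law]_(y in D) f y = \int[P]_(w in Y @^-1` D `&` B) f (Y w).
Proof.
move=> mD mf f0; rewrite ge0_integral_pushforward//; last exact: measurable_funTS.
have mYD : measurable (Y @^-1` D) by exact: measurable_preimageT.
have mfY : measurable_fun (Y @^-1` D) (f \o Y).
  by apply: measurable_funTS; exact: measurableT_comp.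
by rewrite ge0_integral_mrestr// => w _; exact: f0.
Qed.

End restricted_law.

Section conditional_independence.
Context d (Omega : measurableType d) (R : realType) (P : probability Omega R).
Context dY (TY : measurableType dY) dS (TS : measurableType dS).
Context dX (TX : measurableType dX).
Variables (Y : {mfun Omega >-> TY}) (S : {mfun Omega >-> TS})
  (X : {mfun Omega >-> TX}) (K : R.-pker TY ~> TS).

Section density.
Local Open Scope charge_scope.
Variables (B : set TX) (mB : measurable B).

Let mXB : measurable (X @^-1` B). Proof. exact: measurable_preimageT. Qed.

Definition cond_density : TY -> \bar R :=
  ('d (charge_of_finite_measure (restricted_law P Y mXB)) '/d (distribution P Y)).

Lemma cond_density_probability : cond_probability P Y (X @^-1` B) cond_density.
Proof.
split => [|D mD].
  apply: measurable_int; apply: Radon_Nikodym_integrable.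
  exact: restricted_law_dominated.
rewrite -integral_law//; last first.
  apply: measurable_int; apply: Radon_Nikodym_integrable.
  exact: restricted_law_dominated.
rewrite -Radon_Nikodym_integral//; last exact: restricted_law_dominated.
by rewrite [LHS]restricted_lawE setIC.
Qed.

Lemma cond_density_change_of_variables A D : measurable A -> measurable D ->
  \int[distribution P Y]_(y in D) (K y A * cond_density y) =
  \int[P]_(w in Y @^-1` D `&` X @^-1` B) K (Y w) A.
Proof.
move=> mA mD; rewrite Radon_Nikodym_change_of_variables//.
- by apply: ge0_integral_restricted_law => //; exact: measurable_kernel.
- exact: restricted_law_dominated.
- exact: integrable_kernel.
Qed.

End density.

Lemma cond_probability_unique F f g :
  cond_probability P Y F f -> cond_probability P Y F g ->
  (distribution P Y).-integrable [set: TY] f ->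
  ae_eq (distribution P Y) [set: TY] f g.
Proof.
move=> [mf fE] [mg gE] intf; apply: integral_ae_eq => // D _ mD.
by rewrite !integral_law// fE// gE.
Qed.

Variable kappa : TY -> set TS -> \bar R.
Hypothesis kE : forall y A, measurable A -> kappa y A = K y A.

(** For a version g of P(X in B | Y) and the version K( . , A) of P(S in A | Y),
    conditional independence says that P(S in A, X in B, Y in D) is the integral
    of K( . , A) g over D, which is the integral of K(Y, A) over the event
    {X in B, Y in D} since g is the density of the law of Y restricted to
    {X in B}. The two sides are measures in the set of values of (X, Y), so
    rectangles suffice. *)
Lemma cond_distribution_pair :
  cond_distribution P Y S kappa -> cond_independent P S X Y ->
  cond_distribution P (mfun_pair X Y) S (fun z => kappa z.2).
Proof.
move=> hS hI.
pose K' := kpullback K (mk_mfun (@measurable_snd _ _ TX TY)).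
have kE' z A : measurable A -> kappa z.2 A = K' z A by exact: kE.
apply/(cond_distributionP _ _ _ kE') => A D mA mD.
have mSA : measurable (S @^-1` A) by exact: measurable_preimageT.
pose XY := mfun_pair X Y.
have mSAT : measurable ([set: TX * TY] `*` A) by exact: measurableX.
pose q := semidirect (distribution P XY) K'.
(* The integral of K(Y, A) over {(X, Y) in C}, as a measure in C. *)
pose m2 := restricted_law q (mk_mfun (@measurable_fst _ _ (TX * TY)%type TS)) mSAT.
have m2E C : measurable C -> m2 C = \int[P]_(w in XY @^-1` C) K' (XY w) A.
  move=> mC; transitivity (q (C `*` A)).
    by congr (q _); apply/seteqP; split => [[z s]/= [? []]|[z s] []].
  rewrite [LHS]semidirect_rectangle// integral_law//.
  exact: measurable_kernel.
rewrite setIC -m2E//.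
suff -> : m2 D = restricted_law P XY mSA D by [].
apply/esym/finite_measure_eq_rectangles => //.
  by rewrite -ge0_fin_numE// fin_num_measure.
move=> B C mB mC; rewrite [RHS]m2E; last exact: measurableX.
have [f [g [hf hg hfg]]] := hI A B mA mB.
have Kf : ae_eq (distribution P Y) [set: TY] (K ^~ A) f.
  apply: (@cond_probability_unique (S @^-1` A)) => //; last first.
    exact: integrable_kernel.
  have [_ h] := hS A mA; split; first exact: measurable_kernel.
  by move=> E mE; rewrite -h//; apply: eq_integral => w _; rewrite kE.
have gd : ae_eq (distribution P Y) [set: TY] (cond_density mB) g.
  apply: (@cond_probability_unique (X @^-1` B)) => //.
    exact: cond_density_probability.
  by apply: Radon_Nikodym_integrable; exact: restricted_law_dominated.
transitivity (P (S @^-1` A `&` X @^-1` B `&` Y @^-1` C)).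
  congr (P _); apply/seteqP.
  by split => w; rewrite /XY /=; [case => -[]|case => -[]].
rewrite -(proj2 hfg)// -(@integral_law _ _ _ P _ _ Y (fun y => f y * g y))//;
  last exact: (proj1 hfg).
rewrite (ae_eq_integral (fun y => K y A * cond_density mB y))//.
- rewrite cond_density_change_of_variables//.
  by rewrite setIC.
- by apply: measurable_funTS; exact: (proj1 hfg).
- apply: emeasurable_funM; apply: measurable_funTS; first exact: measurable_kernel.
  exact: (proj1 (cond_density_probability mB)).
- by apply: filterS2 Kf gd => y Kfy gdy _; rewrite /= Kfy// gdy.
Qed.

(** If the conditional law of S given (X, Y) only depends on Y, then S and X are
    conditionally independent given Y; the Radon-Nikodym density is the version
    of P(X in B | Y) that the definition asks for. *)
Lemma cond_independent_of_pair :
  cond_distribution P (mfun_pair X Y) S (fun z => kappa z.2) ->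
  cond_independent P S X Y.
Proof.
move=> hS.
pose K' := kpullback K (mk_mfun (@measurable_snd _ _ TX TY)).
have kE' z A : measurable A -> kappa z.2 A = K' z A by exact: kE.
move/(cond_distributionP _ _ _ kE'): hS => hS A B mA mB.
exists (K ^~ A), (cond_density mB); split.
- split => [|D mD]; first exact: measurable_kernel.
  have := hS A ([set: TX] `*` D) mA (measurableX measurableT mD).
  rewrite (_ : mfun_pair X Y @^-1` _ = Y @^-1` D) //.
  by apply/seteqP; split => w //= [].
- exact: cond_density_probability.
- split => [|D mD].
    apply: emeasurable_funM; first exact: measurable_kernel.
    exact: (proj1 (cond_density_probability mB)).
  rewrite -(@integral_law _ _ _ P _ _ Y
    (fun y => K y A * cond_density mB y))//; last first.
    apply: emeasurable_funM; first exact: measurable_kernel.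
    exact: (proj1 (cond_density_probability mB)).
  rewrite cond_density_change_of_variables//.
  have := hS A (B `*` D) mA (measurableX mB mD).
  rewrite (_ : mfun_pair X Y @^-1` _ = Y @^-1` D `&` X @^-1` B) ; last first.
    by apply/seteqP; split => w /= [].
  move=> ->; congr (P _); apply/seteqP.
  by split => w /=; [case => ? []|case => -[]].
Qed.

End conditional_independence.

(** * Measurability of the group operations and Haar measure *)

Section group_measurability.
Context d (G : borelGroupType d).

Lemma measurable_open (U : set G) : open U -> measurable U.
Proof. by move=> oU; rewrite measurable_borelE; exact: sub_sigma_algebra. Qed.

Lemma measurable_invg : measurable_fun [set: G] (fun x : G => x^-1%g).
Proof.
apply: (measurability (@open G)); first by rewrite measurable_borelE.
move=> _ [U oU <-]; rewrite setTI; apply: measurable_open.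
by move/continuousP: (@invg_continuous G); exact.
Qed.

Hypothesis countableG : @second_countable G.

(** Second countability makes the Borel sigma-algebra of G * G the product
    sigma-algebra: an open set of pairs is the union of the countably many basic
    rectangles that it contains. *)
Lemma measurable_mulg :
  measurable_fun [set: G * G] (fun p : G * G => (p.1 * p.2)%g).
Proof.
apply: (measurability (@open G)); first by rewrite measurable_borelE.
move=> _ [U oU <-]; rewrite setTI.
set W := _ @^-1` U.
have oW : open W by move/continuousP: (@mulg_continuous G); exact.
have [B cB [Bopen Bbasis]] := countableG.
pose D := [set AB : set G * set G | [/\ B AB.1, B AB.2 & AB.1 `*` AB.2 `<=` W]].
have cD : countable D.
  apply: (@sub_countable _ _ _ (B `*` B)); last exact: countableX.
  by apply: subset_card_le => -[A1 A2] [/= ? ? _].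
rewrite (_ : W = \bigcup_(AB in D) (AB.1 `*` AB.2)); last first.
  apply/seteqP; split=> [[x y] Wxy|[x y] [[A1 A2] [_ _ +] /= [? ?]]]; last exact.
  have [[V1 V2] /= [V1x V2y] VW] : nbhs (x, y) W by exact: open_nbhs_nbhs.
  have [A1 [BA1 A1x] A1V] := Bbasis x _ V1x.
  have [A2 [BA2 A2y] A2V] := Bbasis y _ V2y.
  exists (A1, A2) => //=; split => //= -[a b] [/= Aa Ab].
  by apply: VW; split; [exact: A1V|exact: A2V].
have /pfcard_geP[->|[f]] := cD; first by rewrite bigcup_set0.
rewrite -(image_eq f) bigcup_image; apply: bigcup_measurable => n _.
have [Bn1 Bn2 _] := @funS _ _ _ _ f n I.
by apply: measurableX; apply: measurable_open; exact: Bopen.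
Qed.

Lemma measurable_fun_mulg d' (T : measurableType d') (f g : T -> G) :
  measurable_fun [set: T] f -> measurable_fun [set: T] g ->
  measurable_fun [set: T] (fun x => (f x * g x)%g).
Proof.
move=> mf mg.
exact: (measurableT_comp measurable_mulg (measurable_fun_pair mf mg)).
Qed.

End group_measurability.

Lemma image_ltransV d (G : borelGroupType d) (u : G) (C : set G) :
  ltrans u^-1%g @` C = ltrans u @^-1` C.
Proof.
apply/seteqP; split => [_ [x Cx <-]|x Cx]; rewrite /ltrans /=.
  by rewrite mulVKg.
by exists (u * x)%g => //; rewrite mulKg.
Qed.

Lemma measurable_ltrans_preimage d (G : borelGroupType d) (u : G)
    (C : set G) : measurable C ->
  measurable (ltrans u @^-1` C : set G).
Proof. by apply: measurable_preimageT; exact: measurable_ltrans. Qed.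

(** A finite left-invariant measure on a group is unimodular. Exchanging the
    integrals in the double integral of f(y^-1 x) gives on one side the integral
    of f and on the other one the integral of f(x^-1), each multiplied by the
    total mass; so the measure is invariant under inversion, which turns left
    translations into right translations. *)
Section haar.
Context d (G : borelGroupType d) (R : realType).
Hypothesis countableG : @second_countable G.
Variable lambda : {finite_measure set G -> \bar R}.
Hypothesis lambda_neq0 : lambda [set: G] != 0.
Hypothesis lambda_left : forall t A, measurable A ->
  lambda (ltrans t @^-1` A) = lambda A.
Implicit Types f : G -> \bar R.

Lemma integral_ltrans t f : measurable_fun [set: G] f -> (forall x, 0 <= f x) ->
  \int[lambda]_x f (t * x)%g = \int[lambda]_x f x.
Proof.
move=> mf f0; rewrite -[RHS](@eq_measure_integral _ _ _ setT lambda
  (pushforward lambda (ltrans t))); last by move=> A mA _; exact: lambda_left.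
by rewrite ge0_integral_pushforward//; exact: measurable_ltrans.
Qed.

Lemma integral_invg f : measurable_fun [set: G] f -> (forall x, 0 <= f x) ->
  \int[lambda]_x f x^-1%g = \int[lambda]_x f x.
Proof.
move=> mf f0.
have lfin : lambda [set: G] \is a fin_num by exact: fin_num_measure.
have mi := @measurable_invg _ G.
have cst (c : \bar R) : \int[lambda]_x c = c * lambda setT by rewrite integral_cst.
suff : (\int[lambda]_x f x) * lambda setT = (\int[lambda]_x f x^-1%g) * lambda setT.
  have l0 : 0 < lambda setT by rewrite lt0e lambda_neq0 measure_ge0.
  by move=> E; apply/le_anti/andP; split; rewrite -(@lee_pmul2r _ (lambda setT))// E.
rewrite -2!cst.
transitivity (\int[lambda]_y \int[lambda]_x f (y^-1 * x)%g).
  by apply: eq_integral => y _; rewrite integral_ltrans.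
rewrite (@fubini_tonelli _ _ _ _ _ lambda lambda (fun p => f (p.1^-1 * p.2)%g))//=.
- apply: eq_integral => x _.
  rewrite -[RHS](integral_ltrans x^-1%g)//; last exact: measurableT_comp.
  by apply: eq_integral => y _; rewrite invgM invgK.
- apply: (measurableT_comp mf); apply: measurable_fun_mulg => //.
  exact: measurableT_comp.
Qed.

Lemma integral_rtrans t f : measurable_fun [set: G] f -> (forall x, 0 <= f x) ->
  \int[lambda]_x f (x * t)%g = \int[lambda]_x f x.
Proof.
move=> mf f0; have mi := @measurable_invg _ G.
rewrite -(@integral_invg (fun x => f (x * t)%g))//; last first.
  by apply: (measurableT_comp mf); exact: measurable_fun_mulg.
transitivity (\int[lambda]_x f (t^-1 * x)^-1%g).
  by apply: eq_integral => x _; rewrite invgM invgK.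
rewrite (@integral_ltrans t^-1%g (fun x => f x^-1%g))//; last exact: measurableT_comp.
exact: integral_invg.
Qed.

End haar.

(** * The transport identity *)

(** The set [good] stands for the values z = (x, mu) with mu(G) > 0: outside it
    the kernels take an arbitrary fixed value, which is not equivariant. *)
Section mass_transport.
Context dG (G : borelGroupType dG) (R : realType).
Hypothesis countableG : @second_countable G.
Variable lambda : {finite_measure set G -> \bar R}.
Hypothesis lambda_neq0 : lambda [set: G] != 0.
Hypothesis lambda_left : forall t A, measurable A ->
  lambda (ltrans t @^-1` A) = lambda A.
Context dZ (Z : measurableType dZ) (act : G -> Z -> Z).
Hypothesis actM : forall s t z, act (s * t)%g z = act s (act t z).
Hypothesis measurable_act :
  measurable_fun [set: G * Z] (fun q : G * Z => act q.1 q.2).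
Variables (p : probability Z R) (k : R.-pker Z ~> G).
Variables (C : set G) (mC : measurable C) (K : R.-pker (Z * G)%type ~> G).
Variable good : set Z.
Hypothesis good_ae : {ae p, forall z, good z}.
Hypothesis good_act : forall s z, good z -> good (act s z).
Hypothesis k_act : forall s z A, good z -> measurable A ->
  k (act s z) A = k z (ltrans s @^-1` A).
Hypothesis KE : forall z u A, good z -> measurable A ->
  k z (ltrans u @^-1` C) != 0 ->
  K (z, u) A = k z (A `&` ltrans u @^-1` C) * (fine (k z (ltrans u @^-1` C)))^-1%:E.
Hypothesis invariant : forall g : Z -> \bar R,
  measurable_fun [set: Z] g -> (forall z, 0 <= g z) ->
  \int[p]_z g z = \int[p]_z \int[k z]_s g (act s^-1%g z).

Definition shift_pair (z : Z) (u v : G) : Z * G := (act v^-1%g z, (u * v)%g).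

Variables (A : set (Z * G)) (mA : measurable A).

(** The probability that a point v drawn from k_z( . | u^-1 C) satisfies
    (v^-1 z, u v) in A. The value zero when u^-1 C has no mass makes [transport]
    equivariant everywhere on [good] and [transportM] true without a
    condition on u. *)
Definition transport z u : \bar R :=
  if k z (ltrans u @^-1` C) == 0 then 0 else K (z, u) (shift_pair z u @^-1` A).

Lemma measurable_shift_pair :
  measurable_fun [set: (Z * G) * G] (fun y => shift_pair y.1.1 y.1.2 y.2).
Proof.
have m11 : measurable_fun [set: (Z * G) * G] (fun y => y.1.1).
  exact: (measurableT_comp measurable_fst measurable_fst).
have m12 : measurable_fun [set: (Z * G) * G] (fun y => y.1.2).
  exact: (measurableT_comp measurable_snd measurable_fst).
apply: measurable_fun_pair; last exact: measurable_fun_mulg.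
have mV : measurable_fun [set: (Z * G) * G] (fun y => y.2^-1%g).
  exact: (measurableT_comp (@measurable_invg _ G)).
exact: (measurableT_comp measurable_act (measurable_fun_pair mV m11)).
Qed.

Let mshift1 z u : measurable (shift_pair z u @^-1` A).
Proof.
apply: measurable_preimageT => //.
exact: (measurableT_comp measurable_shift_pair (pair1_measurable (z, u))).
Qed.

Let mpre := @measurable_ltrans_preimage _ G.

Lemma measurable_transport :
  measurable_fun [set: Z * G] (fun y => transport y.1 y.2).
Proof.
apply: measurable_fun_ifT => //.
- apply: measurable_fun_eqe => //.
  pose D := [set y : (Z * G) * G | C (y.1.2 * y.2)%g].
  have mD : measurable D.
    apply: (measurable_preimageT _ mC); apply: measurable_fun_mulg => //.
    exact: (measurableT_comp measurable_snd measurable_fst).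
  pose k' := kpullback k (mk_mfun (@measurable_fst _ _ Z G)).
  have := @measurable_fun_xsection_finite_kernel _ _ _ _ _ k' D (mem_set mD).
  by congr measurable_fun; apply/funext => y; rewrite xsectionE.
- pose D := (fun y : (Z * G) * G => shift_pair y.1.1 y.1.2 y.2) @^-1` A.
  have mD : measurable D.
    by apply: measurable_preimageT => //; exact: measurable_shift_pair.
  have := @measurable_fun_xsection_finite_kernel _ _ _ _ _ K D (mem_set mD).
  by congr measurable_fun; apply/funext => -[z u]; rewrite xsectionE.
Qed.

Lemma transport_ge0 z u : 0 <= transport z u.
Proof. by rewrite /transport; case: ifP. Qed.

(** The window (w s)^-1 C of s^-1 z is the window w^-1 C of z moved by s^-1, and
    a point s^-1 v of the former leads to the same pair (v^-1 z, w v) as the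
    point v of the latter. *)
Lemma transport_act s z w : good z ->
  transport (act s^-1%g z) (w * s)%g = transport z w.
Proof.
move=> gz.
have E B : ltrans s^-1%g @^-1` (ltrans (w * s)%g @^-1` B) = ltrans w @^-1` B.
  by apply/seteqP; split => v; rewrite /ltrans /= -!mulgA mulVKg.
have EC : k (act s^-1%g z) (ltrans (w * s)%g @^-1` C) = k z (ltrans w @^-1` C).
  by rewrite k_act ?E//; exact: mpre.
rewrite /transport EC; case: ifPn => // kn0.
rewrite !KE ?EC//; last exact: good_act.
congr (_ * _); rewrite k_act//; last by apply: measurableI => //; exact: mpre.
rewrite preimage_setI E; congr (k z (_ `&` _)).
apply/seteqP; split => v;
  rewrite /shift_pair /ltrans /= invgM invgK -actM -mulgA mulgV mulg1.
  by rewrite -mulgA mulVKg.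
by rewrite -mulgA mulVKg.
Qed.

Lemma transportM z w : good z ->
  transport z w * k z (ltrans w @^-1` C) =
  k z (shift_pair z w @^-1` A `&` ltrans w @^-1` C).
Proof.
move=> gz; rewrite /transport; case: ifPn => [/eqP k0|kn0].
  rewrite k0 mul0e; apply/esym/eqP; rewrite -measure_le0 -k0.
  apply: le_measure; rewrite ?inE//; last exact: mpre.
  by apply: measurableI => //; exact: mpre.
have kfin : k z (ltrans w @^-1` C) \is a fin_num.
  by apply: finite_kernel_measure; exact: mpre.
rewrite KE// -muleA -[X in _ * (_ * X)]fineK//.
by rewrite -EFinM mulVf ?mule1// fine_eq0.
Qed.

Definition lifted_transport z := \int[lambda]_u ((\1_C u)%:E * transport z u).

Let slice z := \int[lambda]_u ((\1_C u)%:E * (\1_A (z, u))%:E).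

Let mC1 : measurable_fun [set: G] (fun u => (\1_C u)%:E : \bar R).
Proof. by apply/measurable_EFinP. Qed.

Let mA1 : measurable_fun [set: Z * G] (fun y => (\1_A y)%:E : \bar R).
Proof. by apply/measurable_EFinP. Qed.

Let transport_slice z : measurable_fun [set: G] (transport z).
Proof. exact: (measurableT_comp measurable_transport (pair1_measurable z)). Qed.

(** The chain of equalities at the top of the file, for one value of z. *)
Let integral_lifted_transport z : good z ->
  \int[k z]_s lifted_transport (act s^-1%g z) = \int[k z]_v slice (act v^-1%g z).
Proof.
move=> gz.
(* The substitution u = w s. *)
transitivity (\int[k z]_s \int[lambda]_w ((\1_C (w * s)%g)%:E * transport z w)).
  apply: eq_integral => s _; rewrite /lifted_transport.
  rewrite -[LHS](integral_rtrans _ _ _ s)//.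
  - by apply: eq_integral => w _; rewrite transport_act.
  - exact: emeasurable_funM.
  - by move=> w; rewrite mule_ge0// ?lee_fin// transport_ge0.
have mCm : measurable_fun [set: G * G] (fun q => (\1_C (q.2 * q.1)%g)%:E : \bar R).
  by apply: (measurableT_comp mC1); exact: measurable_fun_mulg.
rewrite (@kernel_tonelli _ _ _ _ _ _ _ k z lambda
  (fun q => (\1_C (q.2 * q.1)%g)%:E * transport z q.2))/=; last 2 first.
- apply: emeasurable_funM => //.
  exact: (measurableT_comp (transport_slice z) measurable_snd).
- by move=> q; rewrite mule_ge0// ?lee_fin// transport_ge0.
transitivity (\int[lambda]_w \int[k z]_v
   ((\1_C (w * v)%g)%:E * (\1_A (shift_pair z w v))%:E)).
  apply: eq_integral => w _.
  have mkC := mpre w mC.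
  have E : (fun v => (\1_C (w * v)%g)%:E * (\1_A (shift_pair z w v))%:E) =
      (fun v => (\1_(shift_pair z w @^-1` A `&` ltrans w @^-1` C) v)%:E : \bar R).
    by apply/funext => v; rewrite -EFinM -[in LHS]mulrC indicI.
  rewrite E integral_indic// ?setIT -?transportM//; last exact: measurableI.
  rewrite ge0_integralZr//; last 2 first.
  - exact: (measurableT_comp mC1 (measurable_ltrans w)).
  - by rewrite transport_ge0.
  rewrite muleC; congr (_ * _).
  rewrite (_ : (fun v => _) = (fun v => (\1_(ltrans w @^-1` C) v)%:E))//.
  by rewrite integral_indic// setIT.
(* The substitution u = w v. *)
rewrite -(@kernel_tonelli _ _ _ _ _ _ _ k z lambda
  (fun q => (\1_C (q.2 * q.1)%g)%:E * (\1_A (shift_pair z q.2 q.1))%:E))/=.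
- apply: eq_integral => v _; rewrite /slice.
  rewrite -[RHS](integral_rtrans _ _ _ v)//.
  apply: emeasurable_funM => //.
  exact: (measurableT_comp mA1 (pair1_measurable _)).
- apply: emeasurable_funM => //; apply: (measurableT_comp mA1).
  have h : measurable_fun [set: G * G] (fun q : G * G => ((z, q.2), q.1)).
    by apply: measurable_fun_pair => //; apply: measurable_fun_pair.
  exact: (measurableT_comp measurable_shift_pair h).
- by move=> q; apply: mule_ge0; rewrite lee_fin.
Qed.

(** Invariance replaces both integrands by their averages over the backward
    shifts of z, and these averages are equal for almost all z. *)
Lemma mass_transport :
  \int[p]_z \int[lambda]_u ((\1_C u)%:E * transport z u) =
  \int[p]_z \int[lambda]_u ((\1_C u)%:E * (\1_A (z, u))%:E).
Proof.
have mCZ : measurable_fun [set: Z * G] (fun y => (\1_C y.2)%:E : \bar R).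
  exact: (measurableT_comp mC1 measurable_snd).
have mPhi : measurable_fun [set: Z] lifted_transport.
  apply: (@measurable_fun_fubini_tonelli_F _ _ _ _ _ lambda
    (fun y => (\1_C y.2)%:E * transport y.1 y.2)).
    by apply: emeasurable_funM => //; exact: measurable_transport.
  by move=> y; rewrite mule_ge0// ?lee_fin// transport_ge0.
have mslice : measurable_fun [set: Z] slice.
  apply: (@measurable_fun_fubini_tonelli_F _ _ _ _ _ lambda
    (fun y => (\1_C y.2)%:E * (\1_A (y.1, y.2))%:E)).
    apply: emeasurable_funM => //.
    by rewrite (_ : (fun x => _) = (fun y => (\1_A y)%:E))//; apply/funext => -[].
  by move=> y; apply: mule_ge0; rewrite lee_fin.
have Phi0 z : 0 <= lifted_transport z.
  by apply: integral_ge0 => u _; rewrite mule_ge0// ?lee_fin// transport_ge0.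
have slice0 z : 0 <= slice z.
  by apply: integral_ge0 => u _; apply: mule_ge0; rewrite lee_fin.
have mk g : measurable_fun [set: Z] g -> (forall z, 0 <= g z) ->
    measurable_fun [set: Z] (fun z => \int[k z]_s g (act s^-1%g z)).
  move=> mg g0.
  apply: (measurable_fun_integral_finite_kernel
    (fun q : Z * G => g (act q.2^-1%g q.1)) k) => //.
  have mV : measurable_fun [set: Z * G] (fun q : Z * G => q.2^-1%g).
    exact: (measurableT_comp (@measurable_invg _ G)).
  apply: (measurableT_comp mg).
  exact: (measurableT_comp measurable_act (measurable_fun_pair mV measurable_fst)).
apply: (etrans (invariant mPhi Phi0)).
apply: (etrans _ (esym (invariant mslice slice0))).
apply: ge0_ae_eq_integral; first exact: measurableT.
- exact: (mk _ mPhi Phi0).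
- exact: (mk _ mslice slice0).
- by move=> z _; apply: integral_ge0 => s _; exact: Phi0.
- by move=> z _; apply: integral_ge0 => s _; exact: slice0.
- by apply: filterS good_ae => z gz _; exact: integral_lifted_transport.
Qed.

End mass_transport.

(** * Kernels on the space of finite measures *)

Section finite_measures_kernel.
Context d (T : measurableType d) (R : realType).
Notation M := (finite_measures T R).

(** The identity; the name is what carries the kernel structure. *)
Definition evaluation_kernel (mu : M) : {measure set T -> \bar R} := mu.

Let measurable_evaluation U : measurable U ->
  measurable_fun [set: M] (evaluation_kernel ^~ U).
Proof.
move=> mU _ B mB; rewrite setTI; apply: sub_sigma_algebra; exists U => //.
by exists B => //; rewrite setTI.
Qed.

HB.instance Definition _ := isKernel.Build _ _ _ _ _
  evaluation_kernel measurable_evaluation.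

Lemma measurable_fun_finite_measures dY (Y : measurableType dY) (f : Y -> M) :
  (forall A, measurable A ->
    measurable_fun [set: Y] (fun y => evaluation_kernel (f y) A)) ->
  measurable_fun [set: Y] f.
Proof.
move=> mf.
pose C := \bigcup_(A in @measurable d T) @preimg_finite_measures_ev d T R A.
apply: (measurability C) => //.
move=> _ [_ [A mA [B mB <-]] <-]; rewrite !setTI.
by apply: measurable_preimageT mB; exact: mf.
Qed.

Variable nu : probability T R.

Definition normalized : R.-pker M ~> T := knormalize evaluation_kernel nu.

Lemma normalizedE (mu : M) A : measurable A -> evaluation_kernel mu setT != 0 ->
  normalized mu A = evaluation_kernel mu A * (fine (evaluation_kernel mu setT))^-1%:E.
Proof.
move=> mA mu0; rewrite /normalized /= /knormalize /mnormalize (negbTE mu0) /=.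
have /negbTE -> // : evaluation_kernel mu setT != +oo.
by rewrite -ltey -ge0_fin_numE// fin_num_measure.
Qed.

Lemma cond_measure_normalized (mu : M) A :
  cond_measure nu (evaluation_kernel mu) setT A = normalized mu A.
Proof.
rewrite [LHS](cond_measureE mu nu measurableT).
rewrite /normalized /= /knormalize /conditioned.
by rewrite /mnormalize /= /mrestr setTI; case: ifPn => // _; rewrite setIT.
Qed.

Lemma normalized_mass (mu : M) A : measurable A ->
  normalized mu A * evaluation_kernel mu setT = evaluation_kernel mu A.
Proof.
move=> mA; have muT : evaluation_kernel mu setT \is a fin_num by exact: fin_num_measure.
have [mu0|mu0] := eqVneq (evaluation_kernel mu setT) 0.
  rewrite mu0 mule0; apply/esym/eqP; rewrite -measure_le0 -[leRHS]mu0.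
  by apply: le_measure; rewrite ?inE.
rewrite normalizedE// -muleA -[X in _ * (_ * X)]fineK//.
by rewrite -EFinM mulVf ?mule1// fine_eq0.
Qed.

(** A finite measure is its total mass times its normalization. Evaluations are
    not uniformly bounded, but the normalizations form a probability kernel, for
    which sections of a measurable set have measurable mass. *)
Lemma measurable_fun_section dY (Y : measurableType dY) (g : Y -> M)
    (D : set (Y * T)) : measurable_fun [set: Y] g -> measurable D ->
  measurable_fun [set: Y] (fun y => evaluation_kernel (g y) (pair y @^-1` D)).
Proof.
move=> mg mD; pose k' := kpullback normalized (mk_mfun mg).
have -> : (fun y => evaluation_kernel (g y) (pair y @^-1` D)) =
    (fun y => k' y (xsection D y) * evaluation_kernel (g y) setT).
  apply/funext => y; rewrite xsectionE [RHS]normalized_mass//.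
  by rewrite -xsectionE; exact: measurable_xsection.
apply: emeasurable_funM.
  by apply: measurable_fun_xsection_finite_kernel; rewrite inE.
exact: (measurableT_comp (measurable_kernel evaluation_kernel _ measurableT)).
Qed.

End finite_measures_kernel.

(** * The action on pairs and the conditional law on a window *)

Section pair_action.
Context dG (G : borelGroupType dG) (R : realType).
Hypothesis countableG : @second_countable G.
Context dE (E : measurableType dE) (act : G -> E -> E).
Hypothesis actP : measurable_action act.
Notation M := (finite_measures G R).
Notation Z := (E * M)%type.

Lemma translate_measureE t (mu : M) A :
  evaluation_kernel (translate_measure t mu) A =
  evaluation_kernel mu (ltrans t @^-1` A).
Proof. by []. Qed.

(** Proof irrelevance: the translates in the action axiom coincide on all sets,
    measurable or not. *)
Lemma finite_measures_eq (m1 m2 : M) :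
  (evaluation_kernel m1 : set G -> \bar R) = evaluation_kernel m2 -> m1 = m2.
Proof.
move: m1 m2 => [m1 [[a1 b1] [c1] [d1] [e1] [f1]]].
move=> [m2 [[a2 b2] [c2] [d2] [e2] [f2]]] /=.
rewrite /evaluation_kernel /= => m12; move: a2 b2 c2 d2 e2 f2; rewrite -{}m12.
move=> a2 b2 c2 d2 e2 f2.
by rewrite (Prop_irrelevance a2 a1) (Prop_irrelevance b2 b1)
  (Prop_irrelevance c2 c1) (Prop_irrelevance d2 d1) (Prop_irrelevance e2 e1)
  (Prop_irrelevance f2 f1).
Qed.

Lemma translate_measureM s t (mu : M) :
  translate_measure (s * t)%g mu = translate_measure s (translate_measure t mu).
Proof.
apply: finite_measures_eq; apply/funext => A.
rewrite !translate_measureE; congr (evaluation_kernel mu _).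
by apply/seteqP; split => x; rewrite /ltrans /= mulgA.
Qed.

Lemma pair_actionM s t (z : Z) :
  pair_action act (s * t)%g z = pair_action act s (pair_action act t z).
Proof. by case: actP => _ actM _; rewrite /pair_action actM translate_measureM. Qed.

Lemma measurable_pair_action :
  measurable_fun [set: G * Z] (fun q : G * Z => pair_action act q.1 q.2).
Proof.
case: actP => _ _ mact; apply: measurable_fun_pair.
  have m21 : measurable_fun [set: G * Z] (fun q : G * Z => q.2.1).
    exact: (measurableT_comp measurable_fst measurable_snd).
  exact: (measurableT_comp mact (measurable_fun_pair measurable_fst m21)).
apply: measurable_fun_finite_measures => A mA.
pose D := [set y : (G * Z) * G | A (y.1.1 * y.2)%g].
have mD : measurable D.
  apply: measurable_preimageT mA; apply: measurable_fun_mulg => //.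
  exact: (measurableT_comp measurable_fst measurable_fst).
(* Any probability measure serves as the value of the normalization at zero. *)
apply: (@measurable_fun_section _ _ _ (\d_ 1%g) _ _ (fun q : G * Z => q.2.2) D) => //.
exact: (measurableT_comp measurable_snd measurable_snd).
Qed.

End pair_action.

Section window_kernel.
Context dG (G : borelGroupType dG) (R : realType).
Hypothesis countableG : @second_countable G.
Context dE (E : measurableType dE).
Variable nu : probability G R.
Notation M := (finite_measures G R).
Notation Z := (E * M)%type.

Lemma normalized_translate s (mu : M) A : measurable A ->
  evaluation_kernel mu setT != 0 ->
  normalized nu (translate_measure s mu) A = normalized nu mu (ltrans s @^-1` A).
Proof.
move=> mA mu0; rewrite !normalizedE//; exact: measurable_ltrans_preimage.
Qed.

Variables (C : set G) (mC : measurable C).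

Definition window_kernel (y : Z * G) : {measure set G -> \bar R} :=
  mrestr (evaluation_kernel y.1.2) (measurable_ltrans_preimage y.2 mC).

Let measurable_window U : measurable U ->
  measurable_fun [set: Z * G] (window_kernel ^~ U).
Proof.
move=> mU; pose D := [set y : (Z * G) * G | U y.2 /\ C (y.1.2 * y.2)%g].
have mD : measurable D.
  apply: measurableI; first exact: (measurable_preimageT _ mU).
  apply: (measurable_preimageT _ mC); apply: measurable_fun_mulg => //.
  exact: (measurableT_comp measurable_snd measurable_fst).
apply: (@measurable_fun_section _ _ _ nu _ _ (fun y : Z * G => y.1.2) D) => //.
exact: (measurableT_comp measurable_snd measurable_fst).
Qed.

HB.instance Definition _ := isKernel.Build _ _ _ _ _
  window_kernel measurable_window.

(** The conditional law mu( . | u^-1 C) of V_C given ((x, mu), u). *)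
Definition cond_window : R.-pker (Z * G)%type ~> G := knormalize window_kernel nu.

Lemma cond_measure_window (y : Z * G) A :
  cond_measure nu y.1.2 (ltrans y.2^-1%g @` C) A = cond_window y A.
Proof.
rewrite image_ltransV.
exact: (cond_measureE y.1.2 nu (measurable_ltrans_preimage y.2 mC) A).
Qed.

Lemma cond_windowE z u A : evaluation_kernel z.2 setT != 0 -> measurable A ->
  normalized nu z.2 (ltrans u @^-1` C) != 0 ->
  cond_window (z, u) A = normalized nu z.2 (A `&` ltrans u @^-1` C) *
    (fine (normalized nu z.2 (ltrans u @^-1` C)))^-1%:E.
Proof.
move=> mu0 mA; have mCu := measurable_ltrans_preimage u mC.
have mACu : measurable (A `&` ltrans u @^-1` C) by exact: measurableI.
have fin B : measurable B -> evaluation_kernel z.2 B \is a fin_num.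
  by move=> mB; exact: fin_num_measure.
rewrite -[LHS](cond_measure_window (z, u) A) !normalizedE//.
rewrite image_ltransV /= /cond_measure.
rewrite -(fineK (fin _ mCu)) -(fineK (fin _ mACu)) => kC0.
have muC0 : fine (evaluation_kernel z.2 (ltrans u @^-1` C)) != 0%R.
  by apply: contraNneq kC0 => ->; rewrite mul0e.
have muT0 : fine (evaluation_kernel z.2 setT) != 0%R by rewrite fine_eq0// fin.
rewrite ifF; last first.
  by apply/negbTE; rewrite -fine_eq0// fin.
rewrite -!EFinM /= invfM invrK -mulrA; congr (_ * _)%:E.
by rewrite mulrCA (mulVf muT0) mulr1.
Qed.

End window_kernel.

(** * Laws invariant under a shift by a typical location *)

Section characterization.
Context (R : realType) dG (G : borelGroupType dG).
Hypothesis countableG : @second_countable G.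
Variable lambda : {finite_measure set G -> \bar R}.
Hypothesis lambda_neq0 : lambda [set: G] != 0.
Hypothesis lambda_left : forall t A, measurable A ->
  lambda (ltrans t @^-1` A) = lambda A.
Context dE (E : measurableType dE) (act : G -> E -> E).
Hypothesis actP : measurable_action act.
Variable nu : probability G R.
Notation M := (finite_measures G R).
Notation Z := (E * M)%type.

Definition mass_kernel : R.-pker Z ~> G :=
  kpullback (normalized nu) (mk_mfun (@measurable_snd _ _ E M)).

Definition backward_shift (q : Z * G) : Z := pair_action act q.2^-1%g q.1.

Lemma measurable_backward_shift : measurable_fun [set: Z * G] backward_shift.
Proof.
have mV : measurable_fun [set: Z * G] (fun q : Z * G => q.2^-1%g).
  exact: (measurableT_comp (@measurable_invg _ G)).
exact: (measurableT_comp (measurable_pair_action countableG actP)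
  (measurable_fun_pair mV measurable_fst)).
Qed.

(** Relation (1) at the top of the file, for indicator functions. *)
Definition mass_invariant (p : probability Z R) : Prop :=
  forall D, measurable D ->
    semidirect p mass_kernel (backward_shift @^-1` D) = p D.

Section invariant_law.
Variable p : probability Z R.
Hypothesis p_inv : mass_invariant p.
Hypothesis p_nontrivial : {ae p, forall z, evaluation_kernel z.2 setT != 0}.

Lemma mass_invariant_integral (g : Z -> \bar R) :
  measurable_fun [set: Z] g -> (forall z, 0 <= g z) ->
  \int[p]_z g z = \int[p]_z \int[mass_kernel z]_s g (pair_action act s^-1%g z).
Proof.
move=> mg g0; have mb := measurable_backward_shift.
have mgb : measurable_fun [set: Z * G] (g \o backward_shift).
  exact: (measurableT_comp mg mb).
rewrite -(ge0_integral_semidirect p mass_kernel mgb); last by move=> y; exact: g0.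
rewrite -(@ge0_integral_pushforward _ _ _ _ _ _ mb _ setT g)//.
by apply: eq_measure_integral => A mA _; apply/esym/p_inv.
Qed.

Variables (C : set G) (mC : measurable C) (C0 : 0 < lambda C).

Notation uniform := (kconst (conditioned lambda nu mC)).
Notation K := (cond_window countableG E nu mC).
Notation forward_shift := (fun y : (Z * G) * G =>
  shift_pair (pair_action act) y.1.1 y.1.2 y.2).

Let measurable_forward : measurable_fun [set: (Z * G) * G] forward_shift.
Proof.
exact: (measurable_shift_pair countableG (measurable_pair_action countableG actP)).
Qed.

Let integral_uniform_pair (h : Z * G -> \bar R) :
  measurable_fun [set: Z * G] h -> (forall y, 0 <= h y) ->
  \int[semidirect p uniform]_y h y = (fine (lambda C))^-1%:E *
    \int[p]_z \int[lambda]_u ((\1_C u)%:E * h (z, u)).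
Proof.
move=> mh h0; rewrite ge0_integral_semidirect//.
have mC2 : measurable_fun [set: Z * G] (fun y => (\1_C y.2)%:E : \bar R).
  by apply/measurable_EFinP; apply: measurableT_comp => //; exact: measurable_snd.
rewrite -ge0_integralZl//; last 3 first.
- apply: (@measurable_fun_fubini_tonelli_F _ _ _ _ _ lambda
    (fun y => (\1_C y.2)%:E * h y)); first exact: emeasurable_funM.
  by move=> y; rewrite mule_ge0// lee_fin.
- by move=> z _; apply: integral_ge0 => u _; rewrite mule_ge0// lee_fin.
- by rewrite lee_fin invr_ge0 fine_ge0.
apply: eq_integral => z _; apply: ge0_integral_conditioned => //.
exact: (measurableT_comp mh (pair1_measurable z)).
Qed.

(** Only an inequality, because [transport] vanishes where [K] has its
    arbitrary value. *)
Lemma shift_law_ge (A : set (Z * G)) : measurable A ->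
  semidirect p uniform A <=
  semidirect (semidirect p uniform) K (forward_shift @^-1` A).
Proof.
move=> mA; have mact := measurable_pair_action countableG actP (R := R).
pose T := transport (pair_action act) mass_kernel C K A.
have mT : measurable_fun [set: Z * G] (fun y => T y.1 y.2).
  exact: (measurable_transport countableG mact mass_kernel mC K mA).
have T0 z u : 0 <= T z u by exact: transport_ge0.
have -> : semidirect p uniform A = \int[semidirect p uniform]_y (\1_A y)%:E.
  by rewrite integral_indic// setIT.
rewrite (@integral_uniform_pair (fun y => (\1_A y)%:E))//;
  last by apply/measurable_EFinP.
rewrite -(mass_transport countableG lambda_neq0 lambda_left (pair_actionM actP)
  mact mC (k := mass_kernel) (K := K) p_nontrivial)//; last 3 first.
- by move=> s z A' z0 mA'; exact: normalized_translate.
- by move=> z u A' z0 mA' kC; exact: cond_windowE.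
- exact: mass_invariant_integral.
rewrite -(@integral_uniform_pair (fun y => T y.1 y.2))//.
rewrite semidirectE; apply: ge0_le_integral => //.
- have mD := measurable_preimageT measurable_forward mA.
  have := @measurable_fun_xsection_finite_kernel _ _ _ _ _ K _ (mem_set mD).
  by congr measurable_fun; apply/funext => y; rewrite xsectionE.
- by move=> [z u] _; rewrite /T /transport /=; case: ifP.
Qed.

Lemma shift_law (A : set (Z * G)) : measurable A ->
  semidirect (semidirect p uniform) K (forward_shift @^-1` A) =
  semidirect p uniform A.
Proof.
move=> mA; apply/esym.
pose q := distribution (semidirect (semidirect p uniform) K)
  (mk_mfun measurable_forward).
exact: (@probability_le_eq _ _ _ (semidirect p uniform) q shift_law_ge).
Qed.

End invariant_law.

End characterization.

(** * The characterization of typicality *)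

Section random_elements.
Context (R : realType) dG (G : borelGroupType dG).
Hypothesis countableG : @second_countable G.
Variable lambda : {finite_measure set G -> \bar R}.
Hypothesis lambda_neq0 : lambda [set: G] != 0.
Hypothesis lambda_left : forall t A, measurable A ->
  lambda (ltrans t @^-1` A) = lambda A.
Context dE (E : measurableType dE) (act : G -> E -> E).
Hypothesis actP : measurable_action act.
Variable nu : probability G R.
Notation M := (finite_measures G R).
Notation Z := (E * M)%type.
Context d (Omega : measurableType d) (P : probability Omega R).
Variables (X : {mfun Omega >-> E}) (xi : {mfun Omega >-> M}).
Hypothesis nontrivial : {ae P, forall w, 0 < evaluation_kernel (xi w) [set: G]}.

Notation XI := (mfun_pair X xi).
Notation p := (distribution P XI).
Notation kappa := (mass_kernel E nu).

Definition lift_pair (Q : extension P) : {mfun ext_space Q >-> Z} :=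
  mfun_pair (X \o ext_proj Q) (xi \o ext_proj Q).

Lemma lift_pair_law Q A : measurable A ->
  distribution (ext_prob Q) (lift_pair Q) A = p A.
Proof. exact: (extension_law Q XI). Qed.

Lemma mass_neq0_ae : {ae p, forall z : Z, evaluation_kernel z.2 setT != 0}.
Proof.
pose A := [set z : Z | evaluation_kernel z.2 setT = 0].
have mA : measurable A.
  rewrite (_ : A = (fun z : Z => evaluation_kernel z.2 setT) @^-1` [set 0])//.
  apply: measurable_preimageT => //.
  exact: (measurableT_comp (measurable_kernel (@evaluation_kernel _ G R) _ measurableT)).
exists A; split => //; last by move=> z /= /negP; rewrite negbK => /eqP.
apply: (measure_negligible (mu := P)); first exact: measurable_preimageT.
apply: negligibleS nontrivial => w /= Aw.
by rewrite Aw ltxx.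
Qed.

Lemma typical_location_law (Q : extension P) (S : {mfun ext_space Q >-> G}) :
  typical_location_for (ext_prob Q) nu
    (X \o ext_proj Q) (xi \o ext_proj Q) S ->
  forall D, measurable D ->
  ext_prob Q ((fun w => pair_action act (S w)^-1%g (lift_pair Q w)) @^-1` D) =
  semidirect p kappa (backward_shift act @^-1` D).
Proof.
move=> [hS hI] D mD.
have mbD : measurable (backward_shift act @^-1` D : set (Z * G)).
  by apply: measurable_preimageT => //; exact: measurable_backward_shift.
rewrite -(@joint_law _ _ _ (ext_prob Q) _ _ _ _ (lift_pair Q) S p kappa
  (fun z => cond_measure nu (evaluation_kernel z.2) setT))//.
- exact: lift_pair_law.
- by move=> z A mA; rewrite cond_measure_normalized.
- apply: (cond_distribution_pair (K := normalized nu) _ hS hI).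
  by move=> mu A mA; rewrite -cond_measure_normalized.
Qed.

(** By the previous lemma the law of S^-1 (X, xi) is the same for all extensions
    and all typical locations. *)
Lemma origin_typicalP :
  origin_typical P act nu X xi <->
  (exists (Q : extension P) (S : {mfun ext_space Q >-> G}),
    typical_location_for (ext_prob Q) nu
      (X \o ext_proj Q) (xi \o ext_proj Q) S) /\
  mass_invariant act nu p.
Proof.
split => -[ex h]; split => //.
  have [Q [S QS]] := ex => D mD.
  rewrite -(typical_location_law QS mD) [LHS](h Q S QS D mD).
  exact: lift_pair_law.
move=> Q S QS D mD; rewrite [LHS](typical_location_law QS mD) h//.
by apply/esym; exact: lift_pair_law.
Qed.

Section window.
Variables (C : set G) (mC : measurable C).
Notation K := (cond_window countableG E nu mC).
Notation uniform := (@kconst _ _ Z _ _ (conditioned lambda nu mC)).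

Lemma uniform_typical_pair_law (Q : extension P) (U V : {mfun ext_space Q >-> G}) :
  uniform_typical_pair (ext_prob Q) nu lambda C
    (X \o ext_proj Q) (xi \o ext_proj Q) U V ->
  (forall D, measurable D ->
    ext_prob Q ((fun w => (lift_pair Q w, U w)) @^-1` D) =
    semidirect p uniform D) /\
  (forall D, measurable D ->
    ext_prob Q ((fun w => ((lift_pair Q w, U w), V w)) @^-1` D) =
    semidirect (semidirect p uniform) K D).
Proof.
move=> [lawU indU hV].
have ZU D : measurable D ->
    ext_prob Q ((fun w => (lift_pair Q w, U w)) @^-1` D) = semidirect p uniform D.
  apply: (@joint_law _ _ _ (ext_prob Q) _ _ _ _ (lift_pair Q) U p uniform
    (fun=> conditioned lambda nu mC)) => //.
    exact: lift_pair_law.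
  apply/cond_distribution_independent => // A mA.
  by rewrite lawU// cond_measureE.
split => //; apply: (@joint_law _ _ _ (ext_prob Q) _ _ _ _
  (mfun_pair (lift_pair Q) U) V (semidirect p uniform) K _ _ _ hV) => //.
by move=> y A mA; exact: cond_measure_window.
Qed.

Lemma uniform_shift_identity_of_invariant (Q : extension P)
    (U V : {mfun ext_space Q >-> G}) :
  0 < lambda C -> mass_invariant act nu p ->
  uniform_typical_pair (ext_prob Q) nu lambda C
    (X \o ext_proj Q) (xi \o ext_proj Q) U V ->
  uniform_shift_identity (ext_prob Q) act
    (X \o ext_proj Q) (xi \o ext_proj Q) U V.
Proof.
move=> C0 pinv /uniform_typical_pair_law [lawU lawV] A mA.
rewrite [RHS](lawU A mA).
rewrite -(shift_law countableG lambda_neq0 lambda_left actP pinv mass_neq0_ae mC C0 mA).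
rewrite -lawV//.
apply: measurable_preimageT mA.
exact: (measurable_shift_pair countableG (measurable_pair_action countableG actP)).
Qed.

(** U_C is added first, with constant kernel, then V_C with the kernel
    [cond_window]. *)
Lemma uniform_typical_pair_exists :
  exists (Q : extension P) (U V : {mfun ext_space Q >-> G}),
    uniform_typical_pair (ext_prob Q) nu lambda C
      (X \o ext_proj Q) (xi \o ext_proj Q) U V.
Proof.
pose Q1 := semidirect_extension P XI uniform.
pose U1 : {mfun ext_space Q1 >-> G} := mk_mfun (@measurable_snd _ _ Omega G).
have lawU1 A : measurable A ->
    pushforward (ext_prob Q1) U1 A = conditioned lambda nu mC A.
  move=> mA; transitivity (ext_prob Q1 (setT `*` A)).
    by congr (ext_prob Q1 _); apply/seteqP; split => [[w s]|[w s] []].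
  rewrite [LHS]semidirect_rectangle//.
  by rewrite integral_cst// -[RHS]mule1; congr (_ * _); exact: probability_setT.
have condU1 : cond_distribution (ext_prob Q1) (XI \o ext_proj Q1) U1
    (fun=> conditioned lambda nu mC).
  exact: semidirect_extension_cond.
have indU1 : independent (ext_prob Q1) U1 (XI \o ext_proj Q1).
  exact/(cond_distribution_independent _ lawU1).
pose Y1 := mfun_pair (XI \o ext_proj Q1) U1.
pose Q2 := semidirect_extension (ext_prob Q1) Y1 K.
pose V2 : {mfun ext_space Q2 >-> G} := mk_mfun (@measurable_snd _ _ (ext_space Q1) G).
exists (comp_extension Q2), (U1 \o ext_proj Q2), V2; split.
- move=> A mA; rewrite [RHS](cond_measureE lambda nu mC) -lawU1//.
  exact: (extension_law Q2 U1).
- move=> A B mA mB.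
  have e1 := extension_law Q2 U1 mA.
  have e2 := extension_law Q2 (XI \o ext_proj Q1) mB.
  have e12 := extension_law Q2 (mfun_pair U1 (XI \o ext_proj Q1)) (measurableX mA mB).
  by rewrite [LHS]e12 [X in _ = X * _]e1 [X in _ = _ * X]e2 -indU1.
- have condV2 := @semidirect_extension_cond _ _ _ (ext_prob Q1) _ _ _ _ Y1 K
    (fun y => cond_measure nu y.1.2 (ltrans y.2^-1%g @` C)).
  by apply: condV2 => y A mA; exact: cond_measure_window.
Qed.

End window.

(** The window u^-1 G is G for every u, so the conditional law of V given
    (X, xi, U) depends on xi only. *)
Lemma typical_location_of_whole_group (Q : extension P)
    (U V : {mfun ext_space Q >-> G}) :
  uniform_typical_pair (ext_prob Q) nu lambda setT
    (X \o ext_proj Q) (xi \o ext_proj Q) U V ->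
  typical_location_for (ext_prob Q) nu
    (X \o ext_proj Q) (xi \o ext_proj Q) V.
Proof.
move=> [_ _ hV].
have kE (y : Z * G) A : measurable A ->
    cond_measure nu y.1.2 (ltrans y.2^-1%g @` setT) A = normalized nu y.1.2 A.
  by move=> mA; rewrite image_ltransV preimage_setT cond_measure_normalized.
have kE' (z : Z) A : measurable A ->
    cond_measure nu (evaluation_kernel z.2) setT A = kappa z A.
  by move=> mA; rewrite cond_measure_normalized.
have kE'' (mu : M) A : measurable A ->
    cond_measure nu (evaluation_kernel mu) setT A = normalized nu mu A.
  by move=> mA; rewrite cond_measure_normalized.
have condV : cond_distribution (ext_prob Q) (lift_pair Q) V
    (fun z => cond_measure nu (evaluation_kernel z.2) setT).
  exact: (@cond_distribution_comp _ _ _ (ext_prob Q) _ _ _ _ _ _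
    (mfun_pair (lift_pair Q) U) V (mk_mfun (@measurable_fst _ _ Z G)) kappa
    _ _ _ kE' hV).
split.
  exact: (@cond_distribution_comp _ _ _ (ext_prob Q) _ _ _ _ _ _
    (lift_pair Q) V (mk_mfun (@measurable_snd _ _ E M)) (normalized nu)
    _ _ _ kE'' condV).
exact: (cond_independent_of_pair (K := normalized nu) kE'' condV).
Qed.

Lemma mass_invariant_of_shift_identity (Q : extension P)
    (U V : {mfun ext_space Q >-> G}) :
  uniform_typical_pair (ext_prob Q) nu lambda setT
    (X \o ext_proj Q) (xi \o ext_proj Q) U V ->
  uniform_shift_identity (ext_prob Q) act
    (X \o ext_proj Q) (xi \o ext_proj Q) U V ->
  mass_invariant act nu p.
Proof.
move=> /typical_location_of_whole_group typV shiftV D mD.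
rewrite -(typical_location_law typV mD) -[RHS](lift_pair_law Q mD).
have := shiftV _ (measurableX mD (@measurableT _ G)).
have E1 T (f : T -> Z) (g : T -> G) :
    (fun w => (f w, g w)) @^-1` (D `*` setT) = f @^-1` D.
  by apply/seteqP; split => w //= [].
by rewrite /pushforward !E1.
Qed.

Lemma origin_typical_characterization :
  origin_typical P act nu X xi <->
  forall C : set G, measurable C -> 0 < lambda C ->
    (exists (Q : extension P) (U V : {mfun ext_space Q >-> G}),
      uniform_typical_pair (ext_prob Q) nu lambda C
        (X \o ext_proj Q) (xi \o ext_proj Q) U V) /\
    (forall (Q : extension P) (U V : {mfun ext_space Q >-> G}),
      uniform_typical_pair (ext_prob Q) nu lambda C
        (X \o ext_proj Q) (xi \o ext_proj Q) U V ->
      uniform_shift_identity (ext_prob Q) act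
        (X \o ext_proj Q) (xi \o ext_proj Q) U V).
Proof.
split => [/origin_typicalP[_ pinv] C mC C0|h].
  split; first exact: uniform_typical_pair_exists.
  by move=> Q U V; exact: uniform_shift_identity_of_invariant.
have lambdaT : 0 < lambda setT by rewrite lt0e lambda_neq0 measure_ge0.
have [[Q [U [V UV]]] shift] := h _ measurableT lambdaT.
apply/origin_typicalP; split.
  by exists Q, V; exact: typical_location_of_whole_group UV.
exact: mass_invariant_of_shift_identity UV (shift _ _ _ UV).
Qed.

End random_elements.

Theorem theorem3p4
  (R : realType)
  (dG : measure_display) (G : borelGroupType dG)
  (compactG : compact [set: G]) (countableG : @second_countable G)
  (lambda : {measure set G -> \bar R}) (haar : haar_measure lambda)
  (dE : measure_display) (E : measurableType dE)
  (act : G -> E -> E) (actP : measurable_action act)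
  (nu : probability G R)
  (d : measure_display) (Omega : measurableType d) (P : probability Omega R)
  (X : {mfun Omega >-> E}) (xi : {mfun Omega >-> finite_measures G R})
  (nontrivial : {ae P, forall w, 0 < xi w [set: G]}) :
  origin_typical P act nu X xi <->
  forall C : set G, measurable C -> 0 < lambda C ->
    (exists (Q : extension P) (U V : {mfun ext_space Q >-> G}),
      uniform_typical_pair (ext_prob Q) nu lambda C
        (X \o ext_proj Q) (xi \o ext_proj Q) U V)
    /\
    (forall (Q : extension P) (U V : {mfun ext_space Q >-> G}),
      uniform_typical_pair (ext_prob Q) nu lambda C
        (X \o ext_proj Q) (xi \o ext_proj Q) U V ->
      uniform_shift_identity (ext_prob Q) act
        (X \o ext_proj Q) (xi \o ext_proj Q) U V).
Proof.
have [lambda_neq0 lambda_compact lambda_left] := haar.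
have lambda_finite := lambda_compact _ measurableT compactG.
apply: (@origin_typical_characterization _ _ _ countableG
  (as_finite_measure lambda_finite)) => //.
move=> t A mA; rewrite -image_ltransV.
exact: lambda_left.
Qed.
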